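(* Let $f(T)$ be an Eisenstein polynomial of degree $n$ over $K$ with root $\pi$, $L=K(\pi)$, $s=v_p(n)$. Let $g(T)$ be another Eisenstein polynomial of degree $n$ over $K$ having a root $\rho\in L$, and suppose $\pi=\rho+\theta\rho^{m+1}+O(\rho^{m+2})$ for an integer $m\ge1$ and $\theta\in\mathcal{O}_K$. Then \[ f(T)\equiv g(T)\mod\sum_{j=0}^sP_{p^j}(\xi_j+n+p^jm), \] and the polynomial $f(\pi+\pi T)-f(\pi)-g(\pi+\pi T)+g(\pi)\in L[T]$ has its Newton polygon contained in the Newton polygon of $f(\pi+\pi^{m+1}T)$.
   Context: $K$ is a local field with finite residue field of characteristic $p$; $v_L$ is the normalized valuation of $L$ (with $v_L=nv_K$ on $K$); $O(\rho^{m+2})$ denotes an element of valuation $\ge m+2$. For integers $a\ge0$ and $w$, $P_{p^a}(w)$ is the $\mathcal{O}_K$-module generated by the monomials $cT^i$ ($c\in K$) with $p^a\mid i$ and $v_L(c)+i\ge w$; the congruence means $f-g$ lies in the sum of these modules. Ramification: $\phi_{L/K}(x)=\frac1n\int_0^x\#\Gamma_t\,dt$ where $\Gamma_t$ is the set of $K$-embeddings $\sigma$ of $L$ with $v_L(\sigma(\pi)/\pi-1)\ge t$. For $0\le\ell\le s$, $\tau_\ell$ is the smallest real $t\ge0$ such that $n\phi_{L/K}$ has slope $\le p^\ell$ on $[t,\infty)$, and $\xi_\ell=n\phi_{L/K}(\tau_\ell)-p^\ell\tau_\ell$. Newton polygons are taken with respect to $v_L$; ''contained in'' means the first polygon lies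 on or above the second.
   Formalization: Newton polygons keep only sides of slope ≤ 0, prolonged horizontally to the right; with positive slopes containment fails: K=Q_7, g=T^3-7, f=(T-7)^3-7, π=ρ+ρ^3, m=2 (T^2 valuation 5, needs 7). Eisenstein polynomials are monic. *)

(* Defs.v *)
From HB Require Import structures.
From mathcomp Require Import all_boot all_order all_algebra all_field.
From mathcomp Require Import finmap.
From mathcomp Require Import all_classical all_reals all_analysis.

Set Implicit Arguments.
Unset Strict Implicit.
Unset Printing Implicit Defensive.

Import Order.TTheory GRing.Theory Num.Theory.

Local Open Scope classical_set_scope.
Local Open Scope ring_scope.

Section Valuations.
Variables (R : realType) (F : fieldType).
Implicit Type v : F -> \bar R.

Record is_valuation v : Prop := IsValuation {
  valuation0 : v 0 = +oo%E ;
  valuation_fin : forall x : F, x != 0 -> v x \is a fin_num ;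
  valuationM : forall x y, v (x * y) = (v x + v y)%E ;
  valuationD : forall x y, (Order.min (v x) (v y) <= v (x + y)%R)%E }.

Definition normalized v : Prop :=
  v @` [set x : F | x != 0] = range (fun z : int => (z%:~R : R)%:E).

Definition valuation_complete v : Prop :=
  forall u : nat -> F,
    (forall e : R, exists N, forall i j, (N <= i)%N -> (N <= j)%N ->
       (e%:E <= v (u i - u j)%R)%E) ->
  exists l, forall e : R, exists N, forall i, (N <= i)%N ->
       (e%:E <= v (u i - l)%R)%E.

(* [res] exhibits [kappa] as the quotient of the valuation ring by its maximal
   ideal; the values of [res] outside the valuation ring are irrelevant. *)
Record is_residue_map v (kappa : fieldType) (res : F -> kappa) : Prop :=
  IsResidueMap {
    residue1 : res 1 = 1 ;
    residueD : forall x y, (0 <= v x)%E -> (0 <= v y)%E ->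
      res (x + y) = res x + res y ;
    residueM : forall x y, (0 <= v x)%E -> (0 <= v y)%E ->
      res (x * y) = res x * res y ;
    residue_surj : forall a, exists2 x, (0 <= v x)%E & res x = a ;
    residue_ker : forall x, (0 <= v x)%E -> (res x = 0 <-> (0 < v x)%E) }.

(* The residue characteristic [p] is prime since it lies in [pchar]. *)
Record is_local_field v (p : nat) (kappa : finFieldType) (res : F -> kappa)
    : Prop := IsLocalField {
  local_valuation : is_valuation v ;
  local_normalized : normalized v ;
  local_complete : valuation_complete v ;
  local_residue : is_residue_map v res ;
  local_pchar : p \in [pchar kappa] }.

Definition Eisenstein v (n : nat) (f : {poly F}) : Prop :=
  [/\ f \is monic, size f = n.+1,
      forall i, (i < n)%N -> (1 <= v f`_i)%E & v f`_0 = 1%E].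

End Valuations.

Section Modules.
Variables (R : realType) (K : fieldType) (L : fieldExtType K).
Variables (vK : K -> \bar R) (vL : L -> \bar R).

Definition is_submodule (M : set {poly K}) : Prop :=
  [/\ M 0, forall g h, M g -> M h -> M (g + h)
    & forall a g, (0 <= vK a)%E -> M g -> M (a *: g)].

Definition Pmod (p a : nat) (w : R) : set {poly K} :=
  smallest is_submodule
    [set h | exists (c : K) (i : nat),
       [/\ (p ^ a %| i)%N, (w%:E <= vL (c%:A)%R + (i%:R : R)%:E)%E
         & h = c *: 'X^i]].

Definition congr_Pmod (p s : nat) (w : nat -> R) (f g : {poly K}) : Prop :=
  exists2 h : 'I_s.+1 -> {poly K},
    (forall j : 'I_s.+1, Pmod p j (w j) (h j)) & f - g = \sum_j h j.

End Modules.

Section Ramification.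
Variables (R : realType) (K : fieldType) (L : fieldExtType K).
Variables (Omega : closedFieldType) (iota : {rmorphism L -> Omega}).
Variables (w : Omega -> \bar R) (p n : nat) (pi : L).

Definition is_algebraic_closure : Prop :=
  forall x : Omega, algebraicOver (iota \o in_alg L) x.

Definition is_Kembedding (sigma : L -> Omega) : Prop :=
  [/\ GRing.zmod_morphism sigma, GRing.monoid_morphism sigma
    & forall a : K, sigma a%:A = iota a%:A].

Definition Gamma (t : R) : set (L -> Omega) :=
  [set sigma | is_Kembedding sigma /\
               (t%:E <= w (sigma pi / iota pi - 1)%R)%E].

Definition phi (x : R) : R :=
  n%:R^-1 * \int[@lebesgue_measure R]_(t in `[0, x]) (#|` fset_set (Gamma t)|%fset)%:R.

(* The map [n * phi] is continuous, so this infimum is a minimum. *)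
Definition tau (l : nat) : R :=
  inf [set t : R | 0 <= t /\
    forall x y, t <= x -> x <= y ->
      n%:R * phi y - n%:R * phi x <= (p ^ l)%:R * (y - x)].

Definition xi (l : nat) : R := n%:R * phi (tau l) - (p ^ l)%:R * tau l.

End Ramification.

(* The region on or above the Newton polygon of [h]. The polygon is the boundary
   of the convex hull of the quadrants [i, +oo[ x [v(h_i), +oo[: its sides have
   nonpositive slopes, and it is prolonged to the right by a horizontal ray. With
   the sides of positive slope retained, the containment below would fail already
   for K = Q_7, f = (T - 7)^3 - 7, g = T^3 - 7, rho^3 = 7, pi = rho + rho^3, m = 2:
   the coefficient of T^2 in f(pi + pi T) - g(pi + pi T) has valuation 5, while
   f(pi + pi^3 T) has coefficients of valuations 5, 7, 9 in degrees 1, 2, 3. *)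
Definition Newton_polygon (R : realType) (L : fieldType) (v : L -> \bar R)
    (h : {poly L}) : set (R^o * R^o) :=
  smallest (@convex_set R (R^o * R^o)%type)
    [set P | exists i : nat, i%:R <= P.1 /\ (v h`_i <= (P.2 : R)%:E)%E].

(* Main.v *)
Require Import Defs.
From HB Require Import structures.
From mathcomp Require Import all_boot all_order all_algebra all_field.
From mathcomp Require Import finmap.
From mathcomp Require Import all_classical all_reals all_analysis.
From mathcomp Require Import measurable_realfun.
From mathcomp Require Import ring lra.

Set Implicit Arguments.
Unset Strict Implicit.
Unset Printing Implicit Defensive.

Import Order.TTheory GRing.Theory Num.Theory.

Local Open Scope classical_set_scope.
Local Open Scope ring_scope.

(** Write [rho = B(pi)] with [B = T + C], [C] over [K] and the terms of [C(pi)] of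
    valuation at least [m + 1]. As [f] divides [g(B(T))], [h = f - g] is the remainder
    of [g(B(T)) - g(T)] modulo [f]. Let [V_j] be the valuation of the coefficient
    of [T^(p^j)] in [f(pi + pi T)]. Up to units it is the minimum over [i] of
    [v_L('C(i, p^j) f_i pi^i)], since the valuations [v_L(f_i pi^i)] are distinct
    modulo [n]; so [f] lies in [\sum_j P_(p^j)(V_j)]. If [g] lies there too, the
    divisibility of binomial and multinomial coefficients by [p] puts
    [g(B(T)) - g(T)] in [\sum_j P_(p^j)(V_j + p^j m)], and reduction modulo [f]
    preserves this module. That [g] lies there is obtained simultaneously, working
    modulo terms of valuation [t] and increasing [t], because [g = f - h].

    The coefficientwise bound on [h] gives the second assertion at the abscissas
    [p^j], where the polygon of [f(pi + pi^(m+1) T)] has its vertices. For the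
    first one, [xi_j + n <= V_j]: the roots [z] of [f(pi + pi T)] satisfy, for any
    [t >= 0], [v(e_(n-k)) >= \sum_z min(t, v(z)) - k t], and the sum bounds
    [\int_0^t #Gamma] because the embeddings of [L] inject into the roots of [f].
    Only this inequality is used, so [L/K] may be inseparable. *)

(** * Valuations and divisibility *)

Section ValuationTheory.
Variables (R : realType) (F : fieldType) (v : F -> \bar R).
Hypothesis Hv : is_valuation v.
Implicit Types (x y z : F).

Lemma valuation1 : v 1 = 0%E.
Proof.
have := valuation_fin Hv (oner_neq0 F); have := valuationM Hv 1 1.
rewrite mulr1; case: (v 1) => // r [] e _; congr _%:E; lra.
Qed.

Lemma valuationN x : v (- x) = v x.
Proof.
have h1 : v (-1) = 0%E.
  have N1 : (-1 : F) != 0 by rewrite oppr_eq0 oner_neq0.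
  have := valuation_fin Hv N1; have := valuationM Hv (-1) (-1).
  rewrite mulrNN mulr1 valuation1; case: (v (-1)) => // r [] e _; congr _%:E; lra.
by rewrite -mulN1r (valuationM Hv) h1 add0e.
Qed.

Lemma valuationX x (a : R) k : v x = a%:E -> v (x ^+ k) = (a *+ k)%:E.
Proof.
move=> vx; elim: k => [|k IH]; first by rewrite expr0 mulr0n valuation1.
by rewrite exprS (valuationM Hv) IH vx -EFinD mulrS.
Qed.

Lemma valuation_eq_pinfty x : v x = +oo%E -> x = 0.
Proof. by move=> vx; apply/eqP; apply: contraT => /(valuation_fin Hv); rewrite vx. Qed.

Lemma valuation_sum_ge (c : \bar R) I (r : seq I) (P : pred I) (G : I -> F) :
  (forall i, P i -> (c <= v (G i))%E) -> (c <= v (\sum_(i <- r | P i) G i))%E.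
Proof.
move=> h; elim/big_ind: _ => //; first by rewrite (valuation0 Hv) leey.
by move=> x y hx hy; apply: le_trans (valuationD Hv x y); rewrite le_min hx hy.
Qed.

Lemma valuation_sum_gt (c : \bar R) I (r : seq I) (P : pred I) (G : I -> F) :
  (c < +oo)%E -> (forall i, P i -> (c < v (G i))%E) ->
  (c < v (\sum_(i <- r | P i) G i))%E.
Proof.
move=> c_fin h; elim/big_ind: _ => //; first by rewrite (valuation0 Hv).
by move=> x y hx hy; apply: lt_le_trans (valuationD Hv x y); rewrite lt_min hx hy.
Qed.

Lemma valuationD_lt x y : (v x < v y)%E -> v (x + y) = v x.
Proof.
move=> xy; apply/eqP; rewrite eq_le; apply/andP; split; last first.
  by apply: le_trans (valuationD Hv x y); rewrite le_min lexx ltW.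
have := valuationD Hv (x + y) (- y); rewrite addrK valuationN ge_min.
by case/orP => // /(lt_le_trans xy); rewrite ltxx.
Qed.

(** Divisibility in the valuation ring. Bounds are kept as elements, so that powers of [p] combine
    without arithmetic on valuations, which are infinite when [p%:R] is 0 in equal
    characteristic. *)
Definition vdvd y x : bool := (v y <= v x)%E.

Lemma vdvdxx x : vdvd x x. Proof. exact: lexx. Qed.
Lemma vdvd0 x : vdvd x 0. Proof. by rewrite /vdvd (valuation0 Hv) leey. Qed.
Lemma vdvd_trans y x z : vdvd x y -> vdvd y z -> vdvd x z.
Proof. exact: le_trans. Qed.

Lemma vdvdN y x : vdvd y (- x) = vdvd y x.
Proof. by rewrite /vdvd valuationN. Qed.

Lemma vdvdM y1 y2 x1 x2 : vdvd y1 x1 -> vdvd y2 x2 -> vdvd (y1 * y2) (x1 * x2).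
Proof. by move=> h1 h2; rewrite /vdvd !(valuationM Hv); exact: leeD. Qed.

Lemma vdvd_mull y x z : vdvd 1 z -> vdvd y x -> vdvd y (z * x).
Proof. by move=> hz hx; rewrite -[y]mul1r; apply: vdvdM. Qed.

Lemma vdvdD y x1 x2 : vdvd y x1 -> vdvd y x2 -> vdvd y (x1 + x2).
Proof. by move=> h1 h2; apply: le_trans (valuationD Hv _ _); rewrite le_min; apply/andP. Qed.

Lemma vdvd_sum y I (r : seq I) (P : pred I) (G : I -> F) :
  (forall i, P i -> vdvd y (G i)) -> vdvd y (\sum_(i <- r | P i) G i).
Proof. exact: valuation_sum_ge. Qed.

Lemma vdvdMn y x k : vdvd y x -> vdvd y (x *+ k).
Proof.
by move=> h; elim: k => [|k IH]; rewrite ?mulr0n ?vdvd0 // mulrS vdvdD.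
Qed.

Lemma vdvd_nat k : vdvd 1 k%:R. Proof. exact/vdvdMn/vdvdxx. Qed.

Lemma vdvdX y x k : vdvd y x -> vdvd (y ^+ k) (x ^+ k).
Proof.
by move=> h; elim: k => [|k IH]; rewrite ?expr0 ?vdvdxx // !exprS vdvdM.
Qed.

Lemma vdvd_dvdn a b : (a %| b)%N -> vdvd a%:R b%:R.
Proof.
by case/dvdnP=> c ->; rewrite natrM vdvd_mull ?vdvd_nat ?vdvdxx.
Qed.

Lemma vdvd_exp x a b : vdvd 1 x -> (a <= b)%N -> vdvd (x ^+ a) (x ^+ b).
Proof.
move=> hx /subnK <-; rewrite exprD vdvd_mull ?vdvdxx //.
by rewrite -(expr1n F (b - a)) vdvdX.
Qed.

Lemma vdvd_mul2l z y x : z != 0 -> vdvd (z * y) (z * x) = vdvd y x.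
Proof.
by move=> z0; rewrite /vdvd !(valuationM Hv) leeD2lE // (valuation_fin Hv).
Qed.

Lemma vdvd_mul2r z y x : z != 0 -> vdvd (y * z) (x * z) = vdvd y x.
Proof. by move=> z0; rewrite ![_ * z]mulrC vdvd_mul2l. Qed.

(* The scaling of Eisenstein polynomials over [K] seen from an extension whose
   valuation restricts to [n] times the one of [K]. *)
Lemma valuation_root_Eisenstein (f : {poly F}) n x : (0 < n)%N ->
  f \is monic -> size f = n.+1 ->
  (forall i, (i < n)%N -> ((n%:R : R)%:E <= v f`_i)%E) ->
  v f`_0 = (n%:R : R)%:E -> root f x -> v x = 1%E.
Proof.
move=> n0 fm fs fi f0 /rootP.
rewrite horner_coef fs big_ord_recr /= -[f`_n]/(f`_n.+1.-1) -fs.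
rewrite -/(lead_coef f) (monicP fm) mul1r => /eqP; rewrite addrC addr_eq0 => /eqP E.
have x0 : x != 0.
  apply/eqP => x0; move: E; rewrite x0 expr0n eqn0Ngt n0 /=.
  case: n n0 fs fi f0 => // n _ fs fi f0; rewrite big_ord_recl big1 ?addr0; last first.
    by move=> i _; rewrite expr0n mulr0.
  by rewrite expr0 mulr1 => /esym/eqP; rewrite oppr_eq0 => /eqP e0; rewrite e0 (valuation0 Hv) in f0.
have := valuation_fin Hv x0; case vx: (v x) => [a| |] // _.
have vi i : (i < n)%N -> ((n%:R + a *+ i)%:E <= v (f`_i * x ^+ i))%E.
  by move=> i_n; rewrite (valuationM Hv) (valuationX _ vx) EFinD leeD2r // fi.
have nR : 0 < n%:R :> R by rewrite ltr0n.
(* If [a < 1], then [a * n < n + a * i] for all [i < n], and the leading term cannot cancel against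
   the others. *)
have a1 : 1 <= a.
  rewrite leNgt; apply/negP => a1.
  have : ((a *+ n)%:E < v (\sum_(i < n) f`_i * x ^+ i))%E.
    apply: valuation_sum_gt => [|i _]; first exact: ltry.
    apply: lt_le_trans (vi _ (ltn_ord i)).
    rewrite lte_fin; move: (ltn_ord i); move: (nat_of_ord i) => j j_n.
    rewrite -(subnK (ltnW j_n)) mulrnDr ltrD2r -mulr_natl.
    move: j_n; rewrite -subn_gt0 -(ltr0n R) natrD.
    set k := (n - j)%:R => k0; have j0 : 0 <= j%:R :> R by [].
    case: (lerP a 0) => a0; nra.
  by rewrite -valuationN -E (valuationX _ vx) ltxx.
case: n n0 fs fi f0 E vi nR => // n _ fs fi f0 E vi nR.
(* Since [a > 0], the constant term has strictly the least valuation among the terms below the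
   leading one. *)
have : v (x ^+ n.+1) = n.+1%:R%:E.
  rewrite E valuationN big_ord_recl /= expr0 mulr1 valuationD_lt // f0.
  apply: valuation_sum_gt => [|i _]; first exact: ltry.
    apply: lt_le_trans (vi (lift ord0 i) (ltn_ord _)).
  by rewrite lte_fin ltrDl pmulrn_lgt0 // (lt_le_trans _ a1).
rewrite (valuationX _ vx) => -[] e; congr _%:E.
by apply: (mulIf (lt0r_neq0 nR)); rewrite mulr_natr e mul1r.
Qed.

End ValuationTheory.

(** * Substitution and reduction *)

(** Compare the powers of [p] on both sides of [k * 'C(i, k) = i * 'C(i.-1, k.-1)]. *)
Lemma dvdn_pfactor_bin p j i k : prime p -> (0 < k)%N -> (p ^ j %| i)%N ->
  (p ^ (j - logn p k) %| 'C(i, k))%N.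
Proof.
move=> p_pr k0 ji; have [->|C0] := posnP 'C(i, k); first exact: dvdn0.
case: k k0 C0 => // k _ C0; case: i ji C0 => [|i] ji C0.
  by rewrite bin0n in C0.
have C1 : (0 < 'C(i, k))%N by move: C0; rewrite !bin_gt0 ltnS.
have e : (logn p k.+1 + logn p 'C(i.+1, k.+1) = logn p i.+1 + logn p 'C(i, k))%N.
  by rewrite -!lognM // -mul_bin_diag.
move: ji; rewrite !pfactor_dvdn // => ji.
by rewrite leq_subLR e; apply: leq_trans ji (leq_addr _ _).
Qed.

Lemma coef_comp_scaleX (S : comNzRingType) (P : {poly S}) (c : S) i :
  (P \Po (c *: 'X))`_i = P`_i * c ^+ i.
Proof.
rewrite comp_polyE coef_sum.
under eq_bigr => k _ do rewrite exprZn !coefZ coefXn.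
case: (ltnP i (size P)) => iP.
  rewrite (bigD1 (Ordinal iP)) //= eqxx mulr1 big1 ?addr0 // => k ki.
  have -> : (i == k) = false by apply: contraNF ki => /eqP e; apply/eqP/val_inj.
  by rewrite !mulr0.
rewrite nth_default // mul0r big1 // => k _.
have -> : (i == k) = false by apply/negbTE; rewrite gtn_eqF // (leq_trans (ltn_ord k)).
by rewrite !mulr0.
Qed.

Section Core.
Variables (R : realType) (L : fieldType) (v : L -> \bar R).
Hypothesis Hv : is_valuation v.
Local Notation dv := (vdvd v).

Lemma vdvd_coefM (a b : L) (P Q : {poly L}) :
  (forall i, dv a P`_i) -> (forall i, dv b Q`_i) -> forall i, dv (a * b) (P * Q)`_i.
Proof.
by move=> hP hQ i; rewrite coefM; apply: (vdvd_sum Hv) => // k _; apply: vdvdM.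
Qed.

Lemma vdvd_coefX (a : L) (P : {poly L}) k :
  (forall i, dv a P`_i) -> forall i, dv (a ^+ k) (P ^+ k)`_i.
Proof.
move=> hP; elim: k => [|k IH] i; last by rewrite !exprS; apply: vdvd_coefM.
by rewrite !expr0 coef1; case: eqP => _; rewrite ?vdvdxx ?vdvd0.
Qed.

Variable p : nat.
Hypothesis p_pr : prime p.

(* A monomial of [P ^+ k] whose exponent is not divisible by [p ^ a.+1] carries a
   multinomial coefficient divisible by [p ^ (b - a)]. *)
Lemma vdvd_coefX_pfactor (u : L) (P : {poly L}) :
  (forall i, dv u P`_i) -> forall k e a b, (p ^ b %| k)%N -> ~~ (p ^ a.+1 %| e)%N ->
  dv (p%:R ^+ (b - a) * u ^+ k) (P ^+ k)`_e.
Proof.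
elim/poly_ind: P => [|P c IH] hP k e a b bk ae.
  rewrite expr0n coefMn coef1; case: e ae => [|e] ae; first by rewrite dvdn0 in ae.
  by rewrite mul0rn vdvd0.
have hc : dv u c by have := hP 0%N; rewrite coefD coefMX coefC /= add0r.
have {}hP i : dv u P`_i by have := hP i.+1; rewrite coefD coefMX coefC /= addr0.
rewrite exprDn_comm; last exact: mulrC.
rewrite coef_sum; apply: (vdvd_sum Hv) => -[q qk] _ /=.
rewrite ltnS in qk; rewrite -bin_sub // coefMn -polyC_exp coefMC exprMn coefMXn.
set r := (k - q)%N; have rk : (r <= k)%N := leq_subr _ _.
rewrite -[q in c ^+ q](subKn qk) -/r.
case: ltnP => [_|re]; first by rewrite mul0r mul0rn vdvd0.
have [r0|r0] := posnP r.
  rewrite r0 expr0 coef1 subn0; case: eqP => [e0|_]; last by rewrite mul0r mul0rn vdvd0.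
  by rewrite e0 dvdn0 in ae.
set y := logn p r.
have hC : dv (p%:R ^+ (b - y)) 'C(k, r)%:R.
  by rewrite -natrX; apply/vdvd_dvdn/dvdn_pfactor_bin.
have hcr : dv (u ^+ (k - r)) (c ^+ (k - r)) by exact: vdvdX.
rewrite -[X in vdvd _ _ X]mulr_natl mulrA -[k in u ^+ k](subnK rk) exprD.
(* The binomial coefficient supplies [p ^ (b - y)], which suffices if [y <= a]. Otherwise [p ^ a.+1]
   divides [r], hence not [e - r], and the induction hypothesis for [P ^+ r] supplies the missing
   [p ^ (y - a)]. *)
have [ya|ya] := leqP y a.
  rewrite (_ : _ * _ = (p%:R ^+ (b - a) * u ^+ r) * u ^+ (k - r)); last by rewrite mulrA mulrAC.
  apply: (vdvdM Hv) => //; apply: (vdvdM Hv); last exact: vdvd_coefX.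
  by apply: vdvd_trans hC; apply: (vdvd_exp Hv (vdvd_nat Hv _)); rewrite leq_sub2l.
have yr : (p ^ y %| r)%N by rewrite pfactor_dvdn.
have ar : ~~ (p ^ a.+1 %| e - r)%N.
  apply: contra ae => h; rewrite -(subnK re) dvdn_add //.
  by apply: dvdn_trans yr; rewrite dvdn_exp2l.
apply: (@vdvd_trans _ _ v ((p%:R ^+ (b - y) * (p%:R ^+ (y - a) * u ^+ r)) * u ^+ (k - r))).
  rewrite [X in vdvd _ _ X](_ : _ = p%:R ^+ ((b - y) + (y - a)) * (u ^+ (k - r) * u ^+ r)); last first.
    by rewrite exprD [u ^+ (k - r) * _]mulrC !mulrA.
  apply: (vdvdM Hv _ (vdvdxx _ _)); apply: (vdvd_exp Hv (vdvd_nat Hv _)).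
  by rewrite leq_subLR addnCA subnKC ?(ltnW ya) // addnC -leq_subLR.
by apply: (vdvdM Hv) => //; apply: (vdvdM Hv) => //; exact: IH.
Qed.

Variables (n : nat) (f : {poly L}) (pi : L).
Hypotheses (n_gt0 : (0 < n)%N) (f_monic : f \is monic) (f_size : size f = n.+1).
Hypotheses (pi0 : pi != 0) (dvpi : dv 1 pi).
Hypothesis dvf : forall i, dv (pi ^+ n) (f`_i * pi ^+ i).
Local Notation s := (logn p n).

Let f_n : f`_n = 1.
Proof. by move/monicP: f_monic; rewrite /lead_coef f_size. Qed.

(* The least value of [ramif_term j i] over the admissible [i] is the ordinate [V_j]
   of the ramification polygon at the abscissa [p ^ j], since
   ['C(i, p ^ j) = p ^ (logn p i - j)] up to a unit. *)
Definition ramif_term j i : L := p%:R ^+ (logn p i - j) * (f`_i * pi ^+ i).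

(* The part of exponent [e] of an element of [\sum_j P_(p^j)(V_j + p^j m)], up to
   terms of valuation at least [t]. *)
Definition coef_in m t e (x : L) : Prop :=
  (exists j i, [/\ (j <= s)%N, (p ^ j %| e)%N, (0 < i <= n)%N, (p ^ j %| i)%N
    & dv (ramif_term j i * pi ^+ (p ^ j * m)) x]) \/ dv (pi ^+ t) x.

Lemma coef_in_le m t e x y : coef_in m t e x -> dv x y -> coef_in m t e y.
Proof.
move=> [[j [i [h1 h2 h3 h4 h5]]]|h] xy; [left|right]; last exact: vdvd_trans xy.
by exists j, i; split=> //; apply: vdvd_trans xy.
Qed.

Lemma coef_in0 m t e : coef_in m t e 0.
Proof. by right; rewrite (vdvd0 Hv). Qed.

Lemma coef_inD m t e x y : coef_in m t e x -> coef_in m t e y -> coef_in m t e (x + y).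
Proof.
move=> hx hy; have [xy|yx] := leP (v x) (v y).
  by apply: coef_in_le hx _; apply: (vdvdD Hv); rewrite ?vdvdxx.
by apply: coef_in_le hy _; apply: (vdvdD Hv); rewrite ?vdvdxx // /vdvd ltW.
Qed.

Lemma coef_inN m t e x : coef_in m t e x -> coef_in m t e (- x).
Proof. by move=> hx; apply: coef_in_le hx _; rewrite vdvdN ?vdvdxx. Qed.

Lemma coef_in_sum m t e I (r : seq I) (P : pred I) (G : I -> L) :
  (forall i, P i -> coef_in m t e (G i)) ->
  coef_in m t e (\sum_(i <- r | P i) G i).
Proof.
by move=> h; elim/big_ind: _ => //; [exact: coef_in0 | exact: coef_inD].
Qed.

Lemma coef_in_weaken m t e x : coef_in m t e x -> coef_in 0 t e x.
Proof.
move=> [[j [i [h1 h2 h3 h4 h5]]]|h]; [left|by right].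
exists j, i; split=> //; apply: vdvd_trans h5.
by apply: (vdvdM Hv (vdvdxx _ _)); apply: (vdvd_exp Hv) => //; rewrite muln0.
Qed.

Lemma ramif_term_n : ramif_term s n = pi ^+ n.
Proof. by rewrite /ramif_term subnn expr0 f_n !mul1r. Qed.

(** Take [j = logn p i] and the term of degree [i] itself. If [i = 0] or [logn p i > s], take
    [j = s] and the leading term, whose bound [pi ^+ n] holds for every term by [dvf]. *)
Lemma coef_in_f t i : coef_in 0 t i (f`_i * pi ^+ i).
Proof.
have [i_n|i_n] := leqP i n; last first.
  by rewrite nth_default ?f_size // mul0r; exact: coef_in0.
have [/andP[i0 i_s]|] := boolP ((0 < i) && (logn p i <= s))%N.
  left; exists (logn p i), i; rewrite i0 i_n pfactor_dvdnn; split=> //.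
  by rewrite muln0 expr0 mulr1 /ramif_term subnn expr0 mul1r vdvdxx.
rewrite negb_and -leqNgt -ltnNge leqn0 => h; left; exists s, n.
rewrite n_gt0 leqnn pfactor_dvdnn muln0 expr0 mulr1 ramif_term_n; split; rewrite ?vdvdxx ?leqnn //.
by case/orP: h => [/eqP ->|/ltnW h]; rewrite ?dvdn0 // (dvdn_trans _ (pfactor_dvdnn p i)) // dvdn_exp2l.
Qed.

Lemma ramif_term_le j0 j i : (j0 <= j)%N -> (p ^ j %| i)%N -> (0 < i)%N ->
  ramif_term j0 i = p%:R ^+ (j - j0) * ramif_term j i.
Proof.
move=> j0j ji i0; rewrite /ramif_term [RHS]mulrA -exprD; congr (_ ^+ _ * _).
by rewrite addnC addnBA // subnK // -pfactor_dvdn.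
Qed.

(** The part of [c * ('X + E) ^+ i] containing [E ^+ k] contributes this to the exponent
    [e = i - k + e']. A bound for [c] at level [j] is lowered to a level [j' <= j] with
    [p ^ j' <= k], so that [E ^+ k] pays for the valuation [p ^ j' * m]. *)
Lemma coef_in_term m t (E : {poly L}) i k e e' c :
  (0 < m)%N -> (forall l, dv (pi ^+ m) E`_l) -> (0 < k)%N -> (e + k = i + e')%N ->
  coef_in 0 t i c -> coef_in m t.+1 e (c * ((E ^+ k)`_e' *+ 'C(i, k))).
Proof.
move=> m0 hE k0 eki [[j [i0 [js ji /andP[i00 i0n] ji0]]]|ct]; last first.
  right; rewrite exprSr; apply: (vdvdM Hv) => //; apply/(vdvdMn Hv).
  apply: vdvd_trans (vdvd_coefX k hE e'); rewrite -exprM -[X in vdvd _ X _]expr1.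
  by apply: (vdvd_exp Hv) => //; rewrite muln_gt0 m0.
rewrite muln0 expr0 mulr1 => hc; left.
suff [j' [j'j j'e j'k hj']] : exists j', [/\ (j' <= j)%N, (p ^ j' %| e)%N, (p ^ j' <= k)%N
    & dv (p%:R ^+ (j - j') * (pi ^+ m) ^+ k) ((E ^+ k)`_e' *+ 'C(i, k))].
  exists j', i0; split=> //; first exact: leq_trans js.
  - by rewrite i00.
  - by apply: dvdn_trans ji0; rewrite dvdn_exp2l.
  - rewrite (ramif_term_le j'j) // -mulrA mulrCA; apply: (vdvdM Hv) => //.
    apply: vdvd_trans hj'; apply: (vdvdM Hv (vdvdxx _ _)).
    by rewrite -exprM mulnC; apply: (vdvd_exp Hv) => //; rewrite leq_mul2l j'k orbT.
set b := logn p k; have pbk : (p ^ b %| k)%N := pfactor_dvdnn p k.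
have hC : dv (p%:R ^+ (j - b)) 'C(i, k)%:R.
  by rewrite -natrX; apply/(vdvd_dvdn Hv)/dvdn_pfactor_bin.
rewrite -[_ *+ 'C(i, k)]mulr_natl.
(* At level [minn j b] the binomial coefficient alone gives the required power of [p]; only the
   divisibility of [e] may fail. *)
have [jbe|jbe] := boolP (p ^ minn j b %| e)%N.
  exists (minn j b); split=> //; first exact: geq_minl.
  - by apply: dvdn_leq => //; apply: dvdn_trans pbk; rewrite dvdn_exp2l ?geq_minr.
  - apply: (vdvdM Hv); last exact: vdvd_coefX.
    by rewrite (_ : j - minn j b = j - b)%N // minnE subKn ?leq_subr.
have e0 : (0 < e)%N by case: e jbe {eki} => //; rewrite dvdn0.
(* Then the level is [a]. As [p ^ a.+1] divides [i] and [k] but not [e], it does not divide [e'],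
   and the multinomial coefficients in [E ^+ k] add [p ^ (b - a)] to the [p ^ (j - b)] of the
   binomial one. *)
set a := logn p e; have ab : (a < minn j b)%N by rewrite ltnNge -pfactor_dvdn.
move: (ab); rewrite leq_min => /andP[aj ab'].
have ae' : ~~ (p ^ a.+1 %| e')%N.
  have : ~~ (p ^ a.+1 %| e)%N by rewrite pfactor_dvdn // -ltnNge.
  apply: contra => h; rewrite -(@dvdn_addl k) ?eki ?dvdn_add //.
    by apply: dvdn_trans ji; rewrite dvdn_exp2l.
  by apply: dvdn_trans pbk; rewrite dvdn_exp2l.
exists a; split; [exact: ltnW | exact: pfactor_dvdnn | |].
  by apply: dvdn_leq => //; apply: dvdn_trans pbk; rewrite dvdn_exp2l // ltnW.
apply: vdvd_trans (vdvdM Hv hC (vdvd_coefX_pfactor hE pbk ae')).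
rewrite mulrA -exprD; apply: (vdvdM Hv _ (vdvdxx _ _)).
apply: (vdvd_exp Hv (vdvd_nat Hv _)).
by rewrite leq_subLR addnCA subnKC ?(ltnW ab') // addnC -leq_subLR.
Qed.

Lemma coef_in_comp m t (F E : {poly L}) :
  (0 < m)%N -> (forall l, dv (pi ^+ m) E`_l) -> (forall i, coef_in 0 t i F`_i) ->
  forall e, coef_in m t.+1 e (F \Po ('X + E) - F)`_e.
Proof.
move=> m0 hE hF e.
rewrite comp_polyE [X in _ - X](_ : F = \sum_(i < size F) F`_i *: 'X^i); last first.
  by rewrite -{1}[F]coefK poly_def.
rewrite -sumrB coef_sum; apply: coef_in_sum => i _.
rewrite -scalerBr coefZ exprDn_comm; last exact: mulrC.
rewrite big_ord_recl bin0 mulr1n subn0 expr0 mulr1 addrAC subrr add0r.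
rewrite coef_sum mulr_sumr; apply: coef_in_sum => k _.
rewrite lift0 coefMn ['X^_ * _]mulrC coefMXn; case: ltnP => ek.
  by rewrite mul0rn mulr0; exact: coef_in0.
apply: coef_in_term => //.
rewrite addnBA //. by rewrite -addnBAC ?leq_subr // subKn ?(ltn_ord k) // addnC.
Qed.

(** Division by [f] trades the exponent [n + i] for the exponents [i + l]. By [dvf] the valuation
    does not drop; only the divisibility of the exponent by [p ^ j] can be lost, and then the level
    drops to [logn p (i + l)]. *)
Lemma coef_in_reduce m t i l c : coef_in m t (n + i) (c * pi ^+ (n + i)) ->
  coef_in m t (i + l) (c * f`_l * pi ^+ (i + l)).
Proof.
have pin0 : pi ^+ n != 0 by rewrite expf_neq0.
have e1 : c * f`_l * pi ^+ (i + l) * pi ^+ n = c * pi ^+ (n + i) * (f`_l * pi ^+ l).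
  by rewrite !exprD -!mulrA; congr (c * _); rewrite mulrCA [RHS]mulrC !mulrA -!mulrA;
     congr (_ * _); rewrite mulrC -!mulrA.
have key x : dv x (c * pi ^+ (n + i)) -> dv x (c * f`_l * pi ^+ (i + l)).
  by move=> hx; rewrite -(vdvd_mul2r Hv _ _ pin0) e1; apply: (vdvdM Hv).
have [l_n|n_l] := leqP l n; last first.
  by rewrite nth_default ?f_size // mulr0 mul0r => _; exact: coef_in0.
move=> [[j [i0 [js ji /andP[i00 i0n] ji0 hc]]]|ct]; last by right; exact: key.
have [je|je] := boolP (p ^ j %| i + l)%N.
  by left; exists j, i0; rewrite i00; split=> //; exact: key.
left; have e0 : (0 < i + l)%N by case: (i + l)%N je => //; rewrite dvdn0.
set a := logn p (i + l); have aj : (a < j)%N by rewrite ltnNge -pfactor_dvdn.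
have pin : (p ^ a.+1 %| n + i)%N by apply: dvdn_trans ji; rewrite dvdn_exp2l.
have pn : (p ^ a.+1 %| n)%N.
  by apply: dvdn_trans (pfactor_dvdnn p n); rewrite dvdn_exp2l // (leq_trans aj).
have pi' : (p ^ a.+1 %| i)%N by rewrite -(dvdn_addr _ pn).
have pl : ~~ (p ^ a.+1 %| l)%N.
  have : ~~ (p ^ a.+1 %| i + l)%N by rewrite pfactor_dvdn // -ltnNge.
  by rewrite dvdn_addr.
have l0 : (0 < l)%N by rewrite lt0n; apply: contraNneq pl => ->; rewrite dvdn0.
have pal : (p ^ a %| l)%N.
  rewrite -(@dvdn_addr i); first exact: pfactor_dvdnn.
  by apply: dvdn_trans pi'; rewrite dvdn_exp2l.
(* Hence [ramif_term a l] is the term of [f] of degree [l], without a power of [p]. That term is a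
   factor of the element to be bounded, and the old bound leaves at least [pi ^+ (p ^ a * m)] for
   the other factor. *)
have la : logn p l = a.
  apply/eqP; rewrite eqn_leq -pfactor_dvdn // pal andbT leqNgt.
  by rewrite -pfactor_dvdn.
exists a, l; rewrite l0 l_n; split=> //.
- exact: leq_trans (ltnW aj) js.
- exact: pfactor_dvdnn.
rewrite /ramif_term la subnn expr0 mul1r -(vdvd_mul2r Hv _ _ pin0) e1.
rewrite -mulrA [X in dv X _]mulrC; apply: (vdvdM Hv _ (vdvdxx _ _)).
apply: vdvd_trans hc; rewrite mulrC; apply: (vdvdM Hv).
  rewrite /ramif_term; apply: (vdvd_mull Hv) => //.
  by rewrite -natrX; exact: vdvd_nat.
by apply: (vdvd_exp Hv) => //; rewrite leq_mul2r leq_exp2l ?prime_gt1 // ltnW ?orbT.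
Qed.

Lemma coef_in_modp m t (F : {poly L}) :
  (forall e, coef_in m t e (F`_e * pi ^+ e)) ->
  forall e, coef_in m t e ((F %% f)`_e * pi ^+ e).
Proof.
have [N] := ubnP (size F); elim: N F => // N IH F FN hF e.
have [Fn|nF] := ltnP (size F) (size f); first by rewrite modp_small.
rewrite f_size in nF; set d := ((size F).-1 - n)%N.
have Fd : (size F).-1 = (n + d)%N.
  by rewrite subnKC // -ltnS (leq_trans nF) // leqSpred.
set G := F - F`_(n + d) *: ('X^d * f).
have -> : F %% f = G %% f.
  by rewrite /G modpD modpN modpZl modp_mull scaler0 subr0.
have coefG k : G`_k = F`_k - F`_(n + d) * (if (k < d)%N then 0 else f`_(k - d)).
  by rewrite coefB coefZ coefXnM.
apply: IH => {e} [|e].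
- rewrite ltnS in FN; apply: leq_trans FN.
  have F0 : (0 < size F)%N by apply: leq_trans nF.
  rewrite -(prednK F0) ltnS Fd; apply/leq_sizeP => k k_nd.
  rewrite coefG ltnNge (leq_trans (leq_addl _ _) k_nd) /=.
  move: k_nd; rewrite leq_eqVlt => /orP[/eqP <-|k_nd].
    by rewrite addnK f_n mulr1 subrr.
  rewrite nth_default ?sub0r; last by rewrite -(prednK F0) Fd.
  rewrite [f`__]nth_default ?mulr0 ?oppr0 // f_size ltn_subRL addnC //.
rewrite coefG; case: ltnP => ed; first by rewrite mulr0 subr0.
rewrite mulrBl; apply: coef_inD => //; apply: coef_inN.
rewrite -[in X in coef_in _ _ X _](subnKC ed) -[in pi ^+ e](subnKC ed).
exact: coef_in_reduce.
Qed.

(* Each comparison of [g] with its image under the substitution gains one unit of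
   precision on what is known of [g], because [g = f - (f - g)]. *)
Lemma coef_in_sub m (g C : {poly L}) :
  (0 < m)%N -> (size (f - g)%R <= n)%N -> (forall i, dv 1 (g`_i * pi ^+ i)) ->
  (forall i, dv (pi ^+ m.+1) (C`_i * pi ^+ i)) -> f %| g \Po ('X + C) ->
  forall t e, coef_in m t e ((f - g)`_e * pi ^+ e).
Proof.
move=> m0 size_h hg hC fdiv.
suff step t : (forall i, coef_in 0 t i (g`_i * pi ^+ i)) ->
    forall e, coef_in m t.+1 e ((f - g)`_e * pi ^+ e).
  have gt t : forall i, coef_in 0 t i (g`_i * pi ^+ i).
    elim: t => [|t IH] i; first by right; rewrite expr0.
    rewrite (_ : g = f - (f - g)); last by rewrite subKr.
    rewrite coefB mulrBl; apply: coef_inD; first exact: coef_in_f.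
    by apply: coef_inN; apply: coef_in_weaken (step _ IH _).
  move=> t e; case: (step _ (gt t) e) => [|h]; [by left | right].
  by apply: vdvd_trans h; apply: (vdvd_exp Hv).
move=> ht e.
(* Modulo [f], the composite vanishes and [- g] is congruent to [f - g], which is already
   reduced. *)
have -> : f - g = (g \Po ('X + C) - g) %% f.
  rewrite modpD modpN (modp_eq0P _ _ fdiv) sub0r -modpN.
  rewrite [X in X %% f](_ : _ = (f - g) - f); last by rewrite addrAC subrr sub0r.
  by rewrite modpD modpN modpp subr0 modp_small ?f_size.
apply: coef_in_modp => {}e.
rewrite -coef_comp_scaleX comp_polyB -comp_polyA comp_polyD comp_polyX.
(* Scaling the variable by [pi] builds the factor [pi ^+ e] into the coefficients; ['X + C] becomes
   [pi *: ('X + E)] with the coefficients of [E] divisible by [pi ^+ m]. *)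
set E := pi^-1 *: (C \Po (pi *: 'X)).
have -> : pi *: 'X + (C \Po (pi *: 'X)) = (pi *: 'X) \Po ('X + E).
  by rewrite comp_polyZ comp_polyX scalerDr scalerA divff // scale1r.
rewrite comp_polyA; apply: coef_in_comp => // [l|i]; last by rewrite coef_comp_scaleX.
by rewrite coefZ coef_comp_scaleX -(vdvd_mul2l Hv _ _ pi0) mulVKf // -exprS.
Qed.

(** Serves the polygons, where the coefficient of degree [k] is a sum of such multiples. At level
    [minn j (logn p k)] one has [p ^ j' <= k], and the binomial coefficient supplies
    [p ^ (j - j')]. *)
Lemma coef_in_bin m t i k x : (0 < k)%N -> coef_in m t i x ->
  (exists j i0, [/\ (p ^ j <= k)%N, (0 < i0 <= n)%N, (p ^ j %| i0)%N
    & dv (ramif_term j i0 * pi ^+ (p ^ j * m)) (x *+ 'C(i, k))])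
  \/ dv (pi ^+ t) (x *+ 'C(i, k)).
Proof.
move=> k0 [[j [i0 [js ji /andP[i00 i0n] ji0 hx]]]|hx]; last by right; exact: vdvdMn.
left; set j' := minn j (logn p k); have j'j : (j' <= j)%N := geq_minl _ _.
exists j', i0; rewrite i00 i0n; split=> //.
- apply: dvdn_leq => //; apply: dvdn_trans (pfactor_dvdnn p k).
  by rewrite dvdn_exp2l ?geq_minr.
- by apply: dvdn_trans ji0; rewrite dvdn_exp2l.
rewrite -[x *+ _]mulr_natl (ramif_term_le j'j) // -mulrA; apply: (vdvdM Hv).
  rewrite -natrX; apply: (vdvd_dvdn Hv).
  by rewrite (_ : j - j' = j - logn p k)%N ?dvdn_pfactor_bin // /j' minnE subKn ?leq_subr.
apply: vdvd_trans hx; apply: (vdvdM Hv (vdvdxx _ _)); apply: (vdvd_exp Hv) => //.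
by rewrite leq_mul2r leq_exp2l ?prime_gt1 // j'j orbT.
Qed.

End Core.

(** * Totally ramified extensions *)

Lemma logn_subr_pfactor p N j k : prime p -> (p ^ j %| N)%N -> (0 < k < p ^ j)%N ->
  (k < N)%N -> logn p (N - k) = logn p k.
Proof.
move=> p_pr jN /andP[k0 kj] kN.
have lt_j x : (0 < x)%N -> ~~ (p ^ j %| x)%N -> (logn p x < j)%N.
  by move=> x0; rewrite pfactor_dvdn // -ltnNge.
have kNj : ~~ (p ^ j %| k)%N by apply/negP => /(dvdn_leq k0); rewrite leqNgt kj.
have Nk0 : (0 < N - k)%N by rewrite subn_gt0.
have NkNj : ~~ (p ^ j %| N - k)%N by rewrite (dvdn_subr (ltnW kN) jN).
apply/eqP; rewrite eqn_leq -!pfactor_dvdn //.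
have dvdN a : (a < j)%N -> (p ^ a %| N)%N.
  by move=> aj; apply: dvdn_trans jN; rewrite dvdn_exp2l // ltnW.
apply/andP; split.
  by rewrite -(dvdn_subr (ltnW kN)) ?pfactor_dvdnn // dvdN // lt_j.
by rewrite dvdn_subr ?pfactor_dvdnn ?(ltnW kN) // dvdN // lt_j.
Qed.

(** ['C(N.-1, r)] is the product of the fractions [(N - k) / k] for [0 < k <= r], each of them a
    [p]-adic unit. *)
Lemma logn_bin_pred_pfactor p N j r : prime p -> (p ^ j %| N)%N -> (0 < N)%N ->
  (r < p ^ j)%N -> logn p 'C(N.-1, r) = 0%N.
Proof.
move=> p_pr jN N0; elim: r => [|r IH] rj; first by rewrite bin0 logn1.
have rN : (r.+1 < N)%N by apply: leq_trans rj _; apply: dvdn_leq.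
have := congr1 (logn p) (mul_bin_left N.-1 r).
rewrite !lognM ?bin_gt0 //; first last.
- by rewrite -ltnS prednK.
- by rewrite -ltnS prednK // ltnW.
- by rewrite subn_gt0 -ltnS prednK.
rewrite IH ?(ltnW rj) // addn0 -subn1 -subnDA add1n (@logn_subr_pfactor _ _ j) //.
by move/eqP; rewrite -[X in _ == X]addn0 eqn_add2l => /eqP.
Qed.

Lemma logn_bin_pfactor p N j : prime p -> (p ^ j %| N)%N -> (0 < N)%N ->
  logn p 'C(N, p ^ j) = (logn p N - j)%N.
Proof.
move=> p_pr jN N0; have pj0 : (0 < p ^ j)%N by rewrite expn_gt0 prime_gt0.
have pjN : (p ^ j <= N)%N by apply: dvdn_leq.
have := congr1 (logn p) (mul_bin_diag N (p ^ j).-1); rewrite prednK //.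
rewrite !lognM ?bin_gt0 //; last by rewrite -ltnS !prednK.
rewrite (@logn_bin_pred_pfactor _ _ j) ?addn0 ?prednK // pfactorK // => ->.
by rewrite addKn.
Qed.

Lemma coef_comp_affine (S : comNzRingType) (P : {poly S}) (a c : S) k :
  (P \Po (a%:P + c *: 'X))`_k =
  \sum_(i < size P) P`_i * (a ^+ (i - k) * c ^+ k *+ 'C(i, k)).
Proof.
rewrite comp_polyE coef_sum; apply: eq_bigr => i _; rewrite coefZ; congr (_ * _).
rewrite exprDn_comm; last exact: mulrC.
rewrite coef_sum.
under eq_bigr => l _ do rewrite coefMn exprZn -polyC_exp coefCM coefZ coefXn.
have [ki|ik] := ltnP k i.+1.
  rewrite (bigD1 (Ordinal ki)) //= eqxx mulr1 big1 ?addr0 // => l lk.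
  have -> : (k == l) = false by apply: contraNF lk => /eqP e; apply/eqP/val_inj.
  by rewrite !mulr0 mul0rn.
rewrite bin_small // mulr0n big1 // => l _.
have -> : (k == l) = false by apply/negbTE; rewrite gtn_eqF // (leq_trans (ltn_ord l)).
by rewrite !mulr0 mul0rn.
Qed.

Section TotallyRamified.
Variables (R : realType) (K : fieldType) (L : fieldExtType K).
Variables (vK : K -> \bar R) (vL : L -> \bar R) (n : nat) (pi : L).
Hypotheses (HvL : is_valuation vL) (HvKn : normalized vK).
Hypothesis HvLK : forall a : K, vL a%:A = ((n%:R : R)%:E * vK a)%E.
Hypothesis vpi : vL pi = 1%E.
Local Notation dv := (vdvd vL).
Local Notation toL := (map_poly (in_alg L)).

(** On nonzero elements of [K] the valuation [vL] is a multiple of [n], so the exponent of [pi] can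
    be read off modulo [n]. *)
Lemma valuation_term_inj (a b : K) (i j : 'I_n) : a != 0 -> b != 0 ->
  vL (a%:A * pi ^+ i) = vL (b%:A * pi ^+ j) -> i = j.
Proof.
have intK (c : K) : c != 0 -> exists z : int, vK c = (z%:~R)%:E.
  move=> c0; have : (vK @` [set x | x != 0]) (vK c) by exists c.
  by rewrite HvKn => -[z _ <-]; exists z.
move=> /intK[y hy] /intK[z hz]; rewrite !(valuationM HvL) !(valuationX HvL _ vpi) !HvLK hy hz.
rewrite -!EFinM -!EFinD => -[].
rewrite !pmulrn -!intrM -!intrD => /eqP; rewrite eqr_int => /eqP e.
apply: val_inj; have := congr1 (fun x : int => (x %% n%:Z)%Z) e.
by rewrite /= ![(n%:Z * _)%R]mulrC !modzMDl !modz_nat !modn_small // => -[].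
Qed.

(** The nonzero terms have distinct valuations, so the sum has the valuation of its least term. *)
Lemma vdvd_term (c : nat -> K) (y : L) :
  dv y (\sum_(i < n) (c i)%:A * pi ^+ i) -> forall i : 'I_n, dv y ((c i)%:A * pi ^+ i).
Proof.
move=> hy i; set T := fun i : 'I_n => (c i)%:A * pi ^+ i.
have pik0 k : pi ^+ k != 0.
  by rewrite expf_neq0 //; apply/eqP => e; move: vpi; rewrite e (valuation0 HvL).
have [ci0|ci] := eqVneq (c i) 0; first by rewrite ci0 scale0r mul0r (vdvd0 HvL).
have [j _ hj] : exists2 j : 'I_n, true & forall k, (vL (T j) <= vL (T k))%E.
  by case: (@Order.TotalTheory.arg_minP _ _ _ i predT (fun k => vL (T k)) isT) => j _ hj; exists j => // k; exact: hj.
have T0 (k : 'I_n) : c k != 0 -> T k != 0.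
  by move=> ck; rewrite mulf_neq0 // -[_%:A]/(in_alg L _) fmorph_eq0.
have Tj : vL (T j) \is a fin_num.
  apply: contraT => hf; have : T j = 0 by apply: contraNeq hf => /(valuation_fin HvL).
  move=> Tj0; have := hj i; rewrite Tj0 (valuation0 HvL) leye_eq => /eqP e.
  by have := valuation_fin HvL (T0 _ ci); rewrite e.
have cj : c j != 0.
  by apply: contraTneq Tj => e; rewrite /T e scale0r mul0r (valuation0 HvL).
apply: (vdvd_trans hy); apply: le_trans (hj i).
rewrite (bigD1 j) //= (valuationD_lt HvL) //.
apply: (valuation_sum_gt HvL) => [|k kj]; first by rewrite ltey_eq Tj.
rewrite lt_neqAle hj andbT; apply: contraNneq kj => e.
have [ck|ck] := eqVneq (c k) 0.
  by move: Tj; rewrite e ck scale0r mul0r (valuation0 HvL).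
by rewrite -(valuation_term_inj cj ck e).
Qed.

Lemma vdvd_coef (P : {poly K}) (y : L) : (size P <= n)%N ->
  dv y (toL P).[pi] -> forall i, dv y ((toL P)`_i * pi ^+ i).
Proof.
move=> Pn hy i; have [i_n|n_i] := ltnP i n; last first.
  by rewrite nth_default ?mul0r ?(vdvd0 HvL) // size_map_poly (leq_trans Pn).
rewrite coef_map; apply: (@vdvd_term (fun i => P`_i) y _ (Ordinal i_n)).
rewrite (@horner_coef_wide _ n) ?size_map_poly // in hy.
by under eq_bigr => k _ do rewrite -[_%:A]/(in_alg L _) -coef_map.
Qed.

Variable f : {poly K}.
Hypothesis f_size : size f = n.+1.
Hypotheses (f_root : root (toL f) pi) (HL : <<1; pi>>%VS = {:L}%VS).

Lemma horner_pi_surj (x : L) : exists2 P : {poly K}, (size P <= n)%N & x = (toL P).[pi].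
Proof.
have : x \in <<1; pi>>%VS by rewrite HL memvf.
case/Fadjoin_polyP => Q /polyOver1P[P ->] ->.
exists (P %% f); first by rewrite -ltnS -f_size ltn_modp -size_poly_gt0 f_size.
rewrite {1}(divp_eq P f) rmorphD rmorphM /= hornerD hornerM.
by rewrite (rootP f_root) mulr0 add0r.
Qed.

(** The remainder vanishes at [pi]; by [vdvd_coef] with [y = 0], all its terms have infinite
    valuation. *)
Lemma dvdp_root_pi (P : {poly K}) : root (toL P) pi -> f %| P.
Proof.
move=> P0; apply/modp_eq0P/eqP; rewrite -(map_poly_eq0 (in_alg L)); apply/eqP/polyP => i.
have Rn : (size (P %% f)%R <= n)%N.
  by rewrite -ltnS -f_size ltn_modp -size_poly_gt0 f_size.
have R0 : (toL (P %% f)).[pi] = 0.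
  move: P0; rewrite {1}(divp_eq P f) rmorphD rmorphM /= rootE hornerD hornerM.
  by rewrite (rootP f_root) mulr0 add0r => /eqP.
have := @vdvd_coef _ 0 Rn; rewrite R0 vdvdxx => /(_ isT i).
rewrite /vdvd (valuation0 HvL) leye_eq coef0 => /eqP /(valuation_eq_pinfty HvL) /eqP.
by rewrite mulf_eq0 expf_eq0 => /orP[/eqP //|/andP[_ /eqP e]]; move: vpi; rewrite e (valuation0 HvL).
Qed.

Variables (p : nat) (kappa : finFieldType) (res : K -> kappa).
Hypotheses (HvK : is_valuation vK) (Hres : is_residue_map vK res).
Hypothesis Hp : p \in [pchar kappa].

Lemma valuation_nat_unit u : ~~ (p %| u)%N -> vK u%:R = 0%E.
Proof.
move=> pu; have v_ge0 k : (0 <= vK k%:R)%E.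
  by rewrite -(valuation1 HvK); exact: (vdvd_nat HvK).
have resn k : res k%:R = k%:R.
  elim: k => [|k IH]; first by apply/(residue_ker Hres); rewrite (valuation0 HvK).
  by rewrite -natr1 (residueD Hres) // ?IH ?(residue1 Hres) ?natr1 // -[1](mulr1n) v_ge0.
apply/eqP; rewrite eq_le v_ge0 andbT leNgt; apply/negP => /(residue_ker Hres (v_ge0 u)).
by rewrite resn => /eqP; rewrite -(dvdn_pcharf Hp) (negPf pu).
Qed.

Lemma ramification_coef_le_term (i j : nat) : (0 < i <= n)%N -> (p ^ j %| i)%N ->
  dv (toL f \Po (pi%:P + pi *: 'X))`_(p ^ j) (ramif_term p (toL f) pi j i).
Proof.
have p_pr := pcharf_prime Hp.
move=> /andP[i0 i_n] ji; rewrite coef_comp_affine size_map_poly f_size big_ord_recl.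
have pj0 : (0 < p ^ j)%N by rewrite expn_gt0 prime_gt0.
rewrite bin_small // mulr0n mulr0 add0r.
(* The term of degree 0 is gone; taking out a factor [pi] brings the exponents [1..n] to the range
   [0..n-1], where [vdvd_term] excludes cancellation. *)
pose c k := f`_k.+1 * 'C(k.+1, p ^ j)%:R.
have eqc (k : nat) : (toL f)`_k.+1 * (pi ^+ (k.+1 - p ^ j) * pi ^+ (p ^ j) *+ 'C(k.+1, p ^ j))
    = (c k)%:A * pi ^+ k * pi.
  rewrite coef_map /c -![_%:A]/(in_alg L _) rmorphM rmorph_nat /= -!mulrA -exprSr.
  have [kj|jk] := leqP (p ^ j) k.+1; first by rewrite -exprD subnK // mulr_natl.
  by rewrite bin_small // mulr0n mul0r.
under eq_bigr => k _ do rewrite lift0 eqc.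
rewrite -mulr_suml; set S := \sum_(k < n) _.
have i1n : (i.-1 < n)%N by rewrite prednK.
have := vdvd_term (vdvdxx _ S) (Ordinal i1n) => /= hS.
apply: (vdvd_trans (vdvdM HvL hS (vdvdxx _ pi))).
rewrite -eqc prednK // /ramif_term.
have ji' : (p ^ j <= i)%N := dvdn_leq i0 ji.
rewrite -exprD subnK // mulrnAr -[X in vdvd _ X _]mulr_natl.
apply: (vdvdM HvL _ (vdvdxx _ _)).
have C0 : (0 < 'C(i, p ^ j))%N by rewrite bin_gt0.
have [u pu ->] := pfactor_coprime p_pr C0.
rewrite logn_bin_pfactor // natrM natrX -[X in vdvd _ _ X]mul1r.
apply: (vdvdM HvL _ (vdvdxx _ _)); rewrite /vdvd (valuation1 HvL).
rewrite -(rmorph_nat (in_alg L)) HvLK valuation_nat_unit ?mule0 //.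
by rewrite -prime_coprime.
Qed.

End TotallyRamified.

(** * Ramification polygon and embeddings *)

(** Each [nu i] is the integral over [[0, tau]] of the indicator of [[0, nu i]], and [c] is at most
    the sum of these indicators. Monotonicity makes [c] measurable. *)
Lemma Rintegral_nat_le (R : realType) (I : eqType) (r : seq I) (nu : I -> R) (tau : R)
    (c : R -> nat) :
  0 <= tau -> {in r, forall i, 0 <= nu i <= tau} -> {homo c : x y / x <= y >-> (y <= x)%N} ->
  (forall t, 0 <= t <= tau -> (c t <= \sum_(i <- r) (t <= nu i)%R)%N) ->
  \int[@lebesgue_measure R]_(t in `[0, tau]) (c t)%:R <= \sum_(i <- r) nu i.
Proof.
move=> tau0 nuP c_mono hc; pose D := (`[0, tau]%classic : set (measurableTypeR R)).
have mD : measurable D by exact: measurable_itv.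
pose g (i : I) (t : measurableTypeR R) := ((\1_(`[0, nu i]%classic : set (measurableTypeR R)) t : R))%:E.
have mg i : measurable_fun D (g i).
  by apply/measurable_EFinP; apply: measurable_indic; exact: measurable_itv.
have mc : measurable_fun D (fun t : measurableTypeR R => ((c t)%:R : R)%:E).
  apply/measurable_EFinP; apply: nonincreasing_measurable => // x y xy.
  by rewrite ler_nat; exact: c_mono.
have int_g : {in r, forall i, \int[@lebesgue_measure R]_(t in D) g i t = (nu i)%:E}%E.
  move=> i /nuP/andP[nu0 nut].
  rewrite /g integral_indic; [|exact: mD|exact: measurable_itv].
  rewrite setIidl; last first.
    move=> x; rewrite /D /= !in_itv /= => /andP[-> /=] xnu; exact: le_trans xnu nut.
  apply: (etrans (lebesgue_measure_itv `[0, nu i]%R)); rewrite /= lte_fin; case: ltP => h; first by rewrite oppr0 adde0.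
  by congr _%:E; apply: le_anti; rewrite nu0.
have le1 : (\int[@lebesgue_measure R]_(t in D) ((c t)%:R : R)%:E <= (\sum_(i <- r) nu i)%:E)%E.
  rewrite -sumEFin -(eq_big_seq _ int_g).
  have g0 i x : D x -> (0 <= g i x)%E by move=> _; rewrite lee_fin indicE.
  rewrite -(ge0_integral_sum (@lebesgue_measure R) mD mg g0).
  apply: (ge0_le_integral _ mD _ mc); first by move=> x _; rewrite lee_fin.
    exact: emeasurable_sum.
  move=> x; rewrite /D /= in_itv /= => /andP[x0 xt].
  rewrite sumEFin lee_fin; apply: le_trans (_ : (\sum_(i <- r) (x <= nu i)%R)%N%:R <= _).
    by rewrite ler_nat hc // x0.
  rewrite natr_sum; apply: ler_sum => i _; rewrite indicE.
  by case: (boolP (x <= nu i)) => // xnu; rewrite mem_set //= in_itv /= x0.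
have ge0 : (0 <= \int[@lebesgue_measure R]_(t in D) ((c t)%:R : R)%:E)%E.
  by apply: integral_ge0 => x _; rewrite lee_fin.
rewrite /Rintegral -lee_fin fineK // ge0_fin_numE //.
exact: le_lt_trans le1 (ltry _).
Qed.

Section ValuationProduct.
Variables (R : realType) (E : fieldType) (v : E -> \bar R) (tau : R).
Hypothesis Hv : is_valuation v.

(** The cap keeps the value real at 0, which occurs for the root [iota pi] of [f]. *)
Definition capped_valuation (x : E) : R := fine (Order.min tau%:E (v x)).

Lemma capped_valuationE x : (capped_valuation x)%:E = Order.min tau%:E (v x).
Proof.
rewrite /capped_valuation; have [->|x0] := eqVneq x 0.
  by rewrite (valuation0 Hv) min_l ?leey.
by rewrite fineK // minEle; case: ifP => // _; apply: (valuation_fin Hv).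
Qed.

Lemma capped_valuation_le_tau x : capped_valuation x <= tau.
Proof. by rewrite -lee_fin capped_valuationE ge_min lexx. Qed.

Lemma capped_valuation_le x : ((capped_valuation x)%:E <= v x)%E.
Proof. by rewrite capped_valuationE ge_min lexx orbT. Qed.

(** Up to sign, the coefficient is a sum of products of all but [k] of the roots, and the omitted
    ones account for at most [k * tau]. *)
Lemma valuation_coef_prod_XsubC (r : seq E) k :
  ((\sum_(x <- r) capped_valuation x - k%:R * tau)%:E
    <= v (\prod_(x <- r) ('X - x%:P))`_k)%E.
Proof.
elim: r k => [|x r IH] k.
  rewrite !big_nil coef1 sub0r; case: k => [|k].
    by rewrite mul0r oppr0 (valuation1 Hv).
  by rewrite (valuation0 Hv) leey.
rewrite !big_cons mulrBl coefB coefXM coefCM.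
apply: le_trans (valuationD Hv _ _); rewrite le_min (valuationN Hv); apply/andP; split.
  case: k => [|k] /=; first by rewrite (valuation0 Hv) leey.
  apply: le_trans (IH k); rewrite lee_fin -natr1.
  have := capped_valuation_le_tau x; lra.
rewrite (valuationM Hv) -addrA EFinD; apply: leeD => //.
exact: capped_valuation_le.
Qed.

End ValuationProduct.

Section RamificationBound.
Variables (R : realType) (K : fieldType) (L : fieldExtType K).
Variables (Omega : closedFieldType) (iota : {rmorphism L -> Omega}).
Variables (w : Omega -> \bar R) (p n : nat) (pi : L) (f : {poly K}).
Hypotheses (Hw : is_valuation w) (n_gt0 : (0 < n)%N).
Local Notation toL := (map_poly (in_alg L)).
Hypothesis L_gen : forall x : L, exists P : {poly K}, x = (toL P).[pi].
Hypothesis f_root : root (toL f) pi.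
Variable r : seq Omega.
Hypothesis f_split : map_poly iota (toL f) = \prod_(z <- r) ('X - z%:P).
Hypothesis pi0 : pi != 0.
Local Notation mu z := (z / iota pi - 1).

Lemma Kembedding_horner sigma (P : {poly K}) x : is_Kembedding iota sigma ->
  sigma (toL P).[x] = (map_poly iota (toL P)).[sigma x].
Proof.
move=> [sB [s1 sM] sK].
have s0 : sigma 0 = 0 by have := sB 0 0; rewrite !subr0 subrr.
have sN y : sigma (- y) = - sigma y by rewrite -sub0r sB s0 sub0r.
have sD y z : sigma (y + z) = sigma y + sigma z by rewrite -{1}[z]opprK sB sN opprK.
elim/poly_ind: P => [|P c IH]; first by rewrite !map_poly0 !horner0 s0.
rewrite !rmorphD !rmorphM /= !map_polyX !map_polyC /= !hornerE /= sD sM IH.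
by congr (_ + _); rewrite sK.
Qed.

(** An embedding is determined by the image of [pi], a root of [f]. Finiteness comes along because
    [fset_set] sends an infinite set to the empty one. *)
Lemma Gamma_finite_le t : finite_set (Gamma iota w pi t) /\
  (#|` fset_set (Gamma iota w pi t)| <= \sum_(z <- r) (t%:E <= w (mu z))%E)%N.
Proof.
set A := Gamma iota w pi t; set s := [seq z <- r | (t%:E <= w (mu z))%E].
pose ev (sigma : L -> Omega) := sigma pi.
have ev_inj sigma sigma' : A sigma -> A sigma' -> ev sigma = ev sigma' -> sigma = sigma'.
  move=> [h _] [h' _] e; apply/funext => x; have [P ->] := L_gen x.
  by rewrite !Kembedding_horner // -/(ev sigma) e.
have ev_s sigma : A sigma -> ev sigma \in s.
  move=> [h ht]; rewrite mem_filter ht /= -root_prod_XsubC -f_split /root.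
  rewrite -Kembedding_horner // (rootP f_root).
  case: h => sB _ _; by have /eqP := sB 0 0; rewrite !subr0 subrr.
have finA : finite_set A.
  have /eq_finite_set <- : (ev @` A #= A)%card.
    by apply: inj_card_eq => x y /set_mem Ax /set_mem Ay; exact: ev_inj.
  apply: (@sub_finite_set _ _ [set` s]); last exact: finite_seq.
  by move=> _ [sigma As <-]; exact: ev_s.
split=> //.
have -> : (\sum_(z <- r) (t%:E <= w (mu z))%E)%N = size s.
  by rewrite size_filter -sum1_count [RHS]big_mkcond; apply: eq_bigr => z _; case: (t%:E <= _)%E.
have <- : #|` [fset ev x | x in fset_set A]%fset| = #|` fset_set A|.
  rewrite card_in_imfset //= => x y.
  by rewrite !in_fset_set // => /set_mem Ax /set_mem Ay; exact: ev_inj.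
apply: uniq_leq_size => [|z]; first exact: fset_uniq.
move=> /imfsetP[sigma /=]; rewrite in_fset_set // => /set_mem As ->.
exact: ev_s.
Qed.

Hypotheses (w_pi : w (iota pi) = 1%E) (w_root : forall z, z \in r -> w z = 1%E).

Lemma valuation_mu_ge0 z : z \in r -> (0 <= w (mu z))%E.
Proof.
move=> zr; rewrite -(valuation1 Hw).
have ip0 : iota pi != 0 by rewrite fmorph_eq0.
have e : w (z / iota pi) = 0%E.
  have := valuationM Hw (z / iota pi) (iota pi); rewrite divfK // w_root // w_pi.
  have : z / iota pi != 0.
    rewrite mulf_neq0 ?invr_eq0 //; apply/eqP => z0.
    by have := w_root zr; rewrite z0 (valuation0 Hw).
  move/(valuation_fin Hw); case: (w _) => // x _ [] h; congr _%:E; lra.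
by apply: (vdvdD Hw); rewrite ?vdvdN // /vdvd ?e (valuation1 Hw).
Qed.

(* Only [0 <= tau] matters here: the supremum over [tau] of
   [n * phi tau - k * tau] is reached at the vertices of the polygon. *)
Lemma ramification_coef_ge (tau : R) k : 0 <= tau ->
  ((n%:R * phi iota w n pi tau - k%:R * tau + (size r)%:R)%:E
    <= w (iota ((toL f \Po (pi%:P + pi *: 'X))`_k)))%E.
Proof.
move=> tau0; have ip0 : iota pi != 0 by rewrite fmorph_eq0.
have nR : (n%:R : R) != 0 by rewrite pnatr_eq0 -lt0n.
(* Over [Omega], the roots of [f(pi + pi T)] are the [mu z], and its leading coefficient is a power
   of [pi]. *)
have -> : iota ((toL f \Po (pi%:P + pi *: 'X))`_k) =
    iota pi ^+ size r * (\prod_(z <- [seq mu z | z <- r]) ('X - z%:P))`_k.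
  rewrite -coef_map map_comp_poly f_split rmorphD /= map_polyC /= map_polyZ /= map_polyX.
  rewrite rmorph_prod /= -coefZ; congr (polyseq _)`_k; rewrite big_map.
  elim: (r) => [|z l IH]; first by rewrite !big_nil expr0 scale1r.
  rewrite !big_cons IH -scalerAr exprS [iota pi * _]mulrC -scalerA; congr (_ *: _).
  rewrite scalerAl; congr (_ * _).
  rewrite comp_polyB comp_polyX comp_polyC scalerBr addrAC addrC; congr (_ + _).
  by rewrite -mul_polyC -polyCM mulrBr mulr1 mulrCA divff // mulr1 polyCB opprB.
rewrite (valuationM Hw) (valuationX Hw _ w_pi) addrC EFinD; apply: leeD => //.
apply: le_trans (valuation_coef_prod_XsubC tau Hw _ _).
rewrite lee_fin lerD2r /phi mulrA divff // mul1r big_map.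
apply: (Rintegral_nat_le tau0) => [z|x y xy|t /andP[_ t_tau]].
- move=> zr; rewrite capped_valuation_le_tau // andbT -lee_fin capped_valuationE //.
  by rewrite le_min lee_fin tau0 valuation_mu_ge0.
- have [fx _] := Gamma_finite_le x; have [fy _] := Gamma_finite_le y.
  apply: fsubset_leq_card; rewrite -fset_set_sub // => sigma [h hy].
  by split=> //; apply: le_trans hy; rewrite lee_fin.
have [_ ht] := Gamma_finite_le t; apply: (leq_trans ht).
apply: leq_sum => z _; rewrite -[(t <= _)%R]lee_fin capped_valuationE // le_min lee_fin.
by rewrite t_tau.
Qed.

End RamificationBound.

(** * The congruence and the polygons *)

Lemma coef_comp_affine_exp (S : comNzRingType) (P : {poly S}) (a : S) m k :
  (P \Po (a%:P + a ^+ m.+1 *: 'X))`_k = (P \Po (a%:P + a *: 'X))`_k * a ^+ (k * m).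
Proof.
rewrite !coef_comp_affine mulr_suml; apply: eq_bigr => i _.
by rewrite -exprM mulSn exprD [(m * k)%N]mulnC -[RHS]mulrA mulrnAl mulrA.
Qed.

Lemma valuation_Eisenstein_root (R : realType) (K E : fieldType) (vK : K -> \bar R)
    (v : E -> \bar R) (j : {rmorphism K -> E}) n (f : {poly K}) x :
  is_valuation v -> (forall a, v (j a) = (n%:R%:E * vK a)%E) -> (0 < n)%N ->
  Eisenstein vK n f -> root (map_poly j f) x -> v x = 1%E.
Proof.
move=> Hv Hj n0 [fm fs fi f0] fx.
apply: (valuation_root_Eisenstein Hv n0 _ _ _ _ fx).
- exact: monic_map.
- by rewrite size_map_poly.
- by move=> i i_n; rewrite coef_map Hj -[X in (X <= _)%E]mule1 lee_pmul2l ?fi // lte_fin ltr0n.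
- by rewrite coef_map Hj f0 mule1.
Qed.

Lemma tau_ge0 (R : realType) (K : fieldType) (L : fieldExtType K)
    (Omega : closedFieldType) (iota : {rmorphism L -> Omega})
    (w : Omega -> \bar R) (p n : nat) (pi : L) (l : nat) :
  0 <= tau iota w p n pi l.
Proof.
rewrite /tau; set A := (X in inf X).
have [->|/set0P A0] := eqVneq A set0; first by rewrite inf0.
by apply: lb_le_inf => // x [].
Qed.

Lemma subset_smallest T (C : set (set T)) (A B : set T) :
  A `<=` B -> smallest C A `<=` smallest C B.
Proof. by move=> AB x hx M [CM BM]; apply: hx; split=> //; apply: subset_trans BM. Qed.

Section PmodSum.
Variables (R : realType) (K : fieldType) (L : fieldExtType K).
Variables (vK : K -> \bar R) (vL : L -> \bar R).

Lemma Pmod_sum (p a : nat) (x : R) (I : Type) (r : seq I) (P : pred I)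
    (c : I -> K) (e : I -> nat) :
  (forall i, P i -> (p ^ a %| e i)%N /\ (x%:E <= vL (c i)%:A + (e i)%:R%:E)%E) ->
  Pmod vK vL p a x (\sum_(i <- r | P i) c i *: 'X^(e i)).
Proof.
move=> h M [[M0 MD _] genM]; elim/big_ind: _ => // i /h[ei ci].
by apply: genM; exists (c i), (e i).
Qed.

(** Choose one level for each exponent and group the monomials of [f - g] by level. *)
Lemma congr_Pmod_coef (p s : nat) (x : nat -> R) (f g : {poly K}) :
  (forall e, exists j, [/\ (j <= s)%N, (p ^ j %| e)%N
     & ((x j)%:E <= vL ((f - g)`_e)%:A + e%:R%:E)%E]) ->
  congr_Pmod vK vL p s x f g.
Proof.
move=> /choice[J hJ].
have Js e : (J e < s.+1)%N by have [] := hJ e.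
pose h (j : 'I_s.+1) := \sum_(e < size (f - g) | Ordinal (Js e) == j) (f - g)`_e *: 'X^e.
exists h => [j|].
  by apply: Pmod_sum => e /eqP <-; have [] := hJ e.
by rewrite -{1}[f - g]coefK poly_def (partition_big (fun e : 'I__ => Ordinal (Js e)) xpredT).
Qed.

End PmodSum.

Theorem theorem2 (R : realType) (p : nat)
  (K : fieldType) (vK : K -> \bar R) (kappa : finFieldType) (res : K -> kappa)
  (HK : is_local_field vK p res)
  (L : fieldExtType K) (vL : L -> \bar R)
  (n : nat) (f g : {poly K}) (pi rho : L)
  (HvL : is_valuation vL) (HvLn : normalized vL)
  (HvLK : forall a : K, vL a%:A = ((n%:R : R)%:E * vK a)%E)
  (Hf : Eisenstein vK n f) (Hpi : root (map_poly (in_alg L) f) pi)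
  (HL : <<1; pi>>%VS = {:L}%VS)
  (Hg : Eisenstein vK n g) (Hrho : root (map_poly (in_alg L) g) rho)
  (Omega : closedFieldType) (iota : {rmorphism L -> Omega})
  (HOmega : is_algebraic_closure iota)
  (w : Omega -> \bar R) (Hw : is_valuation w)
  (HwL : forall x : L, w (iota x) = vL x)
  (m : nat) (hm : (1 <= m)%N) (theta : K) (Htheta : (0 <= vK theta)%E)
  (Hpirho : ((m.+2%:R : R)%:E
             <= vL (pi - (rho + theta%:A * rho ^+ m.+1))%R)%E) :
  let s := logn p n in
  let xi_ := fun j => xi iota w p n pi j in
  let fL := map_poly (in_alg L) f in
  let gL := map_poly (in_alg L) g in
  congr_Pmod vK vL p s (fun j => xi_ j + n%:R + (p ^ j)%:R * m%:R) f g
  /\ Newton_polygon vL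
       ((fL \Po (pi%:P + pi *: 'X)) - (fL.[pi])%:P
        - (gL \Po (pi%:P + pi *: 'X)) + (gL.[pi])%:P)
     `<=` Newton_polygon vL (fL \Po (pi%:P + pi ^+ m.+1 *: 'X)).
Proof.
have HvK := local_valuation HK; have HvKn := local_normalized HK.
have Hres := local_residue HK; have Hchar := local_pchar HK.
have p_pr := pcharf_prime Hchar.
move=> s xi_ fL gL.
have [f_monic f_size fi f0] := Hf; have [g_monic g_size gi g0] := Hg.
have n_gt0 : (0 < n)%N.
  rewrite lt0n; apply/eqP => n0; rewrite n0 in f_size.
  have f1 : f`_0 = 1 by have := monicP f_monic; rewrite /lead_coef f_size.
  by move: f0; rewrite f1 (valuation1 HvK) => -[] /eqP; rewrite eq_sym oner_eq0.
have vpi : vL pi = 1%E by exact: (valuation_Eisenstein_root (j := in_alg L) HvL HvLK n_gt0 Hf Hpi).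
have vrho : vL rho = 1%E by exact: (valuation_Eisenstein_root (j := in_alg L) HvL HvLK n_gt0 Hg Hrho).
have pi0 : pi != 0 by apply/eqP => e; move: vpi; rewrite e (valuation0 HvL).
have vpiX k : vL (pi ^+ k) = (k%:R)%:E by rewrite (valuationX HvL k vpi).
have dvpi : vdvd vL 1 pi by rewrite /vdvd (valuation1 HvL) vpi lee_fin.
have fL_monic : fL \is monic by rewrite monic_map.
have fL_size : size fL = n.+1 by rewrite size_map_poly.
have gL_size : size gL = n.+1 by rewrite size_map_poly.
have dvEis (F : {poly K}) : Eisenstein vK n F ->
    forall i, vdvd vL (pi ^+ n) ((map_poly (in_alg L) F)`_i * pi ^+ i).
  move=> [F_monic F_size Fi _] i; have [i_n|] := ltnP i n.
    rewrite -[pi ^+ n]mulr1; apply: (vdvdM HvL).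
      rewrite /vdvd vpiX coef_map /= HvLK -[X in (X <= _)%E]mule1 lee_pmul2l ?Fi //.
      by rewrite lte_fin ltr0n.
    by rewrite -(expr0 pi); apply: (vdvd_exp HvL).
  rewrite leq_eqVlt => /orP[/eqP <-|n_i].
    have -> : (map_poly (in_alg L) F)`_n = 1.
      by have := monicP F_monic; rewrite coef_map /lead_coef F_size /= => ->; rewrite scale1r.
    by rewrite mul1r vdvdxx.
  by rewrite nth_default ?mul0r ?(vdvd0 HvL) // size_map_poly F_size.
have dvf := dvEis _ Hf.
have hg i : vdvd vL 1 (gL`_i * pi ^+ i).
  apply: vdvd_trans (dvEis _ Hg i); rewrite -(expr0 pi); exact: (vdvd_exp HvL).
have size_h : (size (fL - gL)%R <= n)%N.
  apply/leq_sizeP => k; rewrite leq_eqVlt => /orP[/eqP <-|n_k]; last first.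
    by rewrite coefB !nth_default ?subrr // ?gL_size ?fL_size.
  rewrite coefB !coef_map.
  have := monicP f_monic; rewrite /lead_coef f_size /= => ->.
  by have := monicP g_monic; rewrite /lead_coef g_size /= => ->; rewrite subrr.
have rho_pi : vdvd vL (pi ^+ m.+1) (rho - pi).
  rewrite -(vdvdN HvL) opprB.
  rewrite (_ : pi - rho = (pi - (rho + theta%:A * rho ^+ m.+1)) + theta%:A * rho ^+ m.+1); last by ring.
  apply: (vdvdD HvL).
    by apply: le_trans Hpirho; rewrite vpiX lee_fin ler_nat.
  rewrite /vdvd (valuationM HvL) (valuationX HvL _ vrho) vpiX HvLK leeDr //.
  by apply: mule_ge0 => //; rewrite lee_fin.
(* As [P] has degree less than [n], the bound on [rho - pi] passes to each of its terms. *)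
have [P Pn eP] := horner_pi_surj f_size Hpi HL (rho - pi).
set C := map_poly (in_alg L) P.
have dvC i : vdvd vL (pi ^+ m.+1) (C`_i * pi ^+ i).
  by apply: (vdvd_coef HvL HvKn HvLK vpi Pn); rewrite -eP.
have f_dvd : fL %| gL \Po ('X + C).
  rewrite (_ : _ \Po _ = map_poly (in_alg L) (g \Po ('X + P))); last first.
    by rewrite map_comp_poly rmorphD /= map_polyX.
  rewrite dvdp_map; apply: (dvdp_root_pi HvL HvKn HvLK vpi f_size Hpi).
  rewrite /root map_comp_poly horner_comp rmorphD /= map_polyX hornerD hornerX -eP.
  by rewrite addrC subrK; exact: Hrho.
have coef_h := coef_in_sub HvL p_pr n_gt0 fL_monic fL_size pi0 dvpi dvf hm size_h hg dvC f_dvd.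
set A := fL \Po (pi%:P + pi *: 'X).
have A_term j i : (0 < i <= n)%N -> (p ^ j %| i)%N ->
    vdvd vL A`_(p ^ j) (ramif_term p fL pi j i).
  exact: (ramification_coef_le_term HvL HvKn HvLK vpi f_size HvK Hres Hchar).
split.
- apply: congr_Pmod_coef => e.
  have xi_term j i : (0 < i <= n)%N -> (p ^ j %| i)%N ->
      ((xi_ j + n%:R)%:E <= vL (ramif_term p fL pi j i))%E.
    move=> i0n ji; apply: le_trans (A_term _ _ i0n ji).
    have [r fr] := closed_field_poly_normal (map_poly iota fL).
    rewrite (monicP _) ?monic_map // scale1r in fr.
    have r_n : size r = n.
      have := congr1 (fun q : {poly Omega} => size q) fr.
      by rewrite size_map_poly fL_size size_prod_XsubC => -[].
    have L_gen x : exists Q : {poly K}, x = (map_poly (in_alg L) Q).[pi].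
      by have [Q _ ->] := horner_pi_surj f_size Hpi HL x; exists Q.
    have w_root z : z \in r -> w z = 1%E.
      rewrite -root_prod_XsubC -fr -map_poly_comp => fz.
      apply: (valuation_Eisenstein_root (j := iota \o in_alg L) Hw _ n_gt0 Hf fz).
      by move=> a /=; rewrite HwL HvLK.
    have w_pi : w (iota pi) = 1%E by rewrite HwL.
    have := ramification_coef_ge Hw n_gt0 L_gen Hpi fr pi0 w_pi w_root (p ^ j)
      (tau_ge0 iota w p n pi j).
    by rewrite HwL r_n => h; exact: h.
  have -> : (vL (((f - g)`_e)%:A)%R + (e%:R)%:E = vL ((fL - gL)`_e * pi ^+ e)%R)%E.
    by rewrite (valuationM HvL) vpiX -rmorphB coef_map.
  (* With a precision above [x0], a term bounded only by the precision goes to level 0, where every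
     exponent is allowed. *)
  set x0 := xi_ 0%N + n%:R + (p ^ 0)%:R * m%:R.
  have [[j [i [js je i0n ji hj]]]|ht] := coef_h (Num.bound `|x0|) e.
    exists j; split=> //; apply: le_trans hj; rewrite (valuationM HvL) vpiX EFinD natrM.
    by apply: leeD => //; exact: xi_term.
  exists 0%N; split=> //; apply: le_trans ht; rewrite vpiX lee_fin.
  apply: le_trans (ler_norm _) (ltW _); exact: archi_boundP.
(* It suffices to treat the generating points of the first polygon. *)
apply: subset_smallest => -[x y] [k /= [kx]].
have [->|k0] := posnP k.
  have affine0 (F : {poly L}) : (F \Po (pi%:P + pi *: 'X))`_0 = F.[pi].
    by rewrite -horner_coef0 horner_comp !hornerE ?mulr0 ?addr0.
  by rewrite coefD !coefB !coefC /= !affine0 subrr sub0r addNr (valuation0 HvL) leye_eq.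
have -> : (A - (fL.[pi])%:P - (gL \Po (pi%:P + pi *: 'X)) + (gL.[pi])%:P)`_k =
    \sum_(i < size (fL - gL)) (fL - gL)`_i * pi ^+ i *+ 'C(i, k).
  rewrite coefD !coefB !coefC (gtn_eqF k0) addr0 subr0 /A -coefB -comp_polyB coef_comp_affine.
  apply: eq_bigr => i _; rewrite -[RHS]mulrnAr; have [ki|ik] := leqP k i.
    by rewrite -exprD subnK.
  by rewrite bin_small // !mulr0n.
move=> hy.
(* The sum has valuation at most [y], so one of its terms does. *)
have /existsP[i hi] : [exists i : 'I_(size (fL - gL)),
    (vL ((fL - gL)`_i * pi ^+ i *+ 'C(i, k))%R <= y%:E)%E].
  apply: contraLR hy; rewrite negb_exists => /forallP hN; rewrite -ltNge.
  by apply: (valuation_sum_gt HvL) => [|i _]; rewrite ?ltry // ltNge hN.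
have [[j [i0 [jk i0n ji0 hj]]]|ht] :=
    coef_in_bin HvL p_pr dvpi k0 (coef_h (Num.bound `|y|) i); last first.
  have := le_trans ht hi; rewrite vpiX lee_fin leNgt => /negP[].
  apply: le_lt_trans (ler_norm _) _; exact: archi_boundP.
(* The point lies in the quadrant at abscissa [p ^ j <= k]; with the precision above [y], only this
   alternative is left. *)
exists (p ^ j)%N; split => /=; first by apply: le_trans kx; rewrite ler_nat.
rewrite coef_comp_affine_exp; apply: le_trans hi; apply: le_trans hj.
exact: (vdvdM HvL (A_term _ _ i0n ji0) (vdvdxx _ _)).
Qed.
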